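(* Let $p,q$ be nonnegative integers, let $\kappa_1,\dots,\kappa_p,\mu_1,\dots,\mu_q$ be complex numbers none of which is in $\{0,-1,-2,\dots\}$, let $\alpha,\beta\in\mathbb{C}$ with $\Re(\alpha)>0$, let $\lambda_2,\lambda_3\in\mathbb{C}$ with $\Re(\lambda_3)>\Re(\lambda_2)>0$, let $\rho\in\mathbb{C}$ with $\Re(\rho)>0$, and let $z\in\mathbb{C}$. Then the M-confluent hypergeometric function has the integral representations $$\begin{aligned} {}^{M}\Phi_{p,q}^{(\alpha,\beta)}(\lambda_{2};\lambda_{3};z;\rho)&=\frac{1}{B(\lambda_{2},\lambda_{3}-\lambda_{2})}\int_{0}^{1}t^{\lambda_{2}-1}(1-t)^{\lambda_{3}-\lambda_{2}-1}\exp(zt)\\ &\quad\times{}_{p}^{\alpha}M^{\beta}_{q}\left(\kappa_{1},\ldots,\kappa_{p};\mu_{1},\ldots,\mu_{q};\frac{-\rho}{t(1-t)}\right)dt,\\ {}^{M}\Phi_{p,q}^{(\alpha,\beta)}(\lambda_{2};\lambda_{3};z;\rho)&=\frac{1}{B(\lambda_{2},\lambda_{3}-\lambda_{2})}\int_{0}^{1}u^{\lambda_{3}-\lambda_{2}-1}(1-u)^{\lambda_{2}-1}\exp\big(z(1-u)\big)\\ &\quad\times{}_{p}^{\alpha}M^{\beta}_{q}\left(\kappa_{1},\ldots,\kappa_{p};\mu_{1},\ldots,\mu_{q};\frac{-\rho}{u(1-u)}\right)du. \end{aligned}$$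
   Context: $(\lambda)_m=\Gamma(\lambda+m)/\Gamma(\lambda)$, $(\lambda)_0=1$ is the Pochhammer symbol and $B(x,y)=\int_0^1 t^{x-1}(1-t)^{y-1}dt$ is the classical beta function. The generalized M-series is $${}_{p}^{\alpha}M^{\beta}_{q}(\kappa_{1},\ldots,\kappa_{p};\mu_{1},\ldots,\mu_{q};z)=\sum_{m=0}^{\infty}\frac{(\kappa_{1})_{m}\cdots(\kappa_p)_{m}}{(\mu_1)_{m}\cdots(\mu_q)_{m}}\frac{z^{m}}{\Gamma(\alpha m+\beta)}.$$ With parameters $\kappa_1,\dots,\kappa_p;\mu_1,\dots,\mu_q$ suppressed from the notation, the modified beta (M-beta) and modified confluent hypergeometric (M-confluent hypergeometric) functions are $${}^{M}B_{p,q}^{(\alpha,\beta)}(x,y;\rho)=\int_{0}^{1}t^{x-1}(1-t)^{y-1}\,{}_{p}^{\alpha}M^{\beta}_{q}\left(\kappa_{1},\ldots,\kappa_{p};\mu_{1},\ldots,\mu_{q};\frac{-\rho}{t(1-t)}\right) dt,$$ $${}^{M}\Phi_{p,q}^{(\alpha,\beta)}(\lambda_{2};\lambda_{3};z;\rho)=\sum_{n=0}^{\infty}\frac{{}^{M}B_{p,q}^{(\alpha,\beta)}(\lambda_{2}+n,\lambda_{3}-\lambda_{2};\rho)}{B(\lambda_{2},\lambda_{3}-\lambda_{2})}\frac{z^{n}}{n!}.$$ These functions are defined for those parameters and arguments for which the series and integrals converge. *)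

(* Defs.v *)
From Stdlib Require Import Reals List ZArith.
From Coquelicot Require Export Coquelicot.

Open Scope R_scope.
Open Scope C_scope.

Definition ex_Cseries (a : nat -> C) : Prop :=
  @ex_series C_AbsRing C_NormedModule a.

Definition Cseries (a : nat -> C) : C :=
  (Series (fun n => Re (a n)), Series (fun n => Im (a n))).

(* Improper Riemann integrals over (0,1): the limits at 0 and at 1 are taken
   independently, and conditional convergence is allowed. *)
Definition ex_int01 (f : R -> C) : Prop :=
  exists I : C,
    @is_RInt_gen C_R_NormedModule f (at_right 0) (at_left 1) I.

Definition int01 (f : R -> C) : C :=
  @RInt_gen C_R_CompleteNormedModule f (at_right 0) (at_left 1).

Definition Cexp (z : C) : C :=
  ((exp (Re z) * cos (Im z))%R, (exp (Re z) * sin (Im z))%R).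

(* Principal value of t^s; only used for t > 0. *)
Definition Rcpow (t : R) (s : C) : C := Cexp (s * RtoC (ln t)).

Definition Cprod_list (l : list C) : C := fold_right Cmult 1 l.

Definition nonpos_int (z : C) : Prop :=
  exists k : nat, z = - RtoC (INR k).

(* Euler's integral, convergent for Re z > 0. *)
Definition Gamma_int (z : C) : C :=
  @RInt_gen C_R_CompleteNormedModule
    (fun t : R => Rcpow t (z - 1) * RtoC (exp (- t)))
    (at_right 0) (Rbar_locally p_infty).

Definition rising (z : C) (n : nat) : C :=
  Cprod_list (map (fun k : nat => z + RtoC (INR k)) (seq 0 n)).

(* Least n with Re z + n > 0 (so n = 0 when Re z > 0). *)
Definition Gamma_shift (z : C) : nat := Z.to_nat (up (- Re z)).

(* The entire function 1/Gamma, by the continuation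
   1/Gamma(z) = z (z+1) ... (z+n-1) / Gamma(z+n); it takes the value 0 at the
   poles of Gamma. *)
Definition rGamma (z : C) : C :=
  rising z (Gamma_shift z) / Gamma_int (z + RtoC (INR (Gamma_shift z))).

(* Meaningful away from the poles 0, -1, -2, ... *)
Definition Gamma (z : C) : C := / rGamma z.

Definition poch (l : C) (m : nat) : C :=
  Gamma (l + RtoC (INR m)) / Gamma l.

Definition Beta (x y : C) : C :=
  int01 (fun t : R => Rcpow t (x - 1) * Rcpow (1 - t) (y - 1)).

(* kappa and mu list the parameters, so p and q are their lengths.
   alpha * m + beta may be a pole of Gamma for finitely many m; such terms
   vanish, since 1/Gamma is zero there. *)
Definition Mterm (kappa mu : list C) (alpha beta z : C) (m : nat) : C :=
  Cprod_list (map (fun k => poch k m) kappa)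
  / Cprod_list (map (fun k => poch k m) mu)
  * (Cpow z m * rGamma (alpha * RtoC (INR m) + beta)).

Definition ex_Mseries (kappa mu : list C) (alpha beta z : C) : Prop :=
  ex_Cseries (Mterm kappa mu alpha beta z).

Definition Mseries (kappa mu : list C) (alpha beta z : C) : C :=
  Cseries (Mterm kappa mu alpha beta z).

Definition Marg (rho : C) (t : R) : C := - rho / RtoC (t * (1 - t)).

Definition MBeta_integrand (kappa mu : list C) (alpha beta x y rho : C)
    (t : R) : C :=
  Rcpow t (x - 1) * Rcpow (1 - t) (y - 1)
  * Mseries kappa mu alpha beta (Marg rho t).

(* Domain of definition of MBeta. *)
Definition ex_MBeta (kappa mu : list C) (alpha beta x y rho : C) : Prop :=
  (forall t : R, (0 < t < 1)%R ->
     ex_Mseries kappa mu alpha beta (Marg rho t)) /\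
  ex_int01 (MBeta_integrand kappa mu alpha beta x y rho).

Definition MBeta (kappa mu : list C) (alpha beta x y rho : C) : C :=
  int01 (MBeta_integrand kappa mu alpha beta x y rho).

Definition MPhi_term (kappa mu : list C) (alpha beta l2 l3 z rho : C)
    (n : nat) : C :=
  MBeta kappa mu alpha beta (l2 + RtoC (INR n)) (l3 - l2) rho
  / Beta l2 (l3 - l2) * (Cpow z n / RtoC (INR (fact n))).

(* Domain of definition of MPhi. *)
Definition ex_MPhi (kappa mu : list C) (alpha beta l2 l3 z rho : C) : Prop :=
  (forall n : nat,
     ex_MBeta kappa mu alpha beta (l2 + RtoC (INR n)) (l3 - l2) rho) /\
  ex_Cseries (MPhi_term kappa mu alpha beta l2 l3 z rho).

Definition MPhi (kappa mu : list C) (alpha beta l2 l3 z rho : C) : C :=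
  Cseries (MPhi_term kappa mu alpha beta l2 l3 z rho).

(* Main.v *)
(** Write g for the integrand of M-beta at (lambda_2, lambda_3 - lambda_2).  Its
    improper integral may converge only conditionally, so dominated convergence
    is not available.  Instead, the M-series converges along a whole ray, hence g is
    continuous on (0,1), and its antiderivative F extends continuously to
    [0,1].  Integration by parts turns the integral of phi g, for phi of class
    C^1, into phi(1) F(1) - phi(0) F(0) minus the proper integral of phi' F.  With
    phi(t) = sum c_n t^n of infinite radius, sum and integral can then be
    exchanged by uniform convergence of phi' on [0,1]; take phi(t) = exp(zt).
    The second representation is the first one under t = 1 - u. *)

Require Import Defs.
From Stdlib Require Import Reals List Factorial Lra Lia.
From Coquelicot Require Import Coquelicot.

Open Scope R_scope.

(** * Improper integrals over (0,1) and antiderivatives continuous up to the endpoints *)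

Lemma locally_01 (t : R) : 0 < t < 1 -> locally t (fun y => 0 < y < 1).
Proof.
intros Ht; apply (open_and _ _ (open_gt 0) (open_lt 1)); exact Ht.
Qed.

(** Side conditions on improper integrals concern all points between an endpoint near 0 and an
    endpoint near 1. Both endpoints may be taken inside (0,1), so facts known on the open interval
    suffice. *)
Lemma unit_interval_filter (P : R -> Prop) :
  (forall t, 0 < t < 1 -> P t) ->
  filter_prod (at_right 0) (at_left 1)
    (fun ab => forall x, Rmin (fst ab) (snd ab) <= x <= Rmax (fst ab) (snd ab) -> P x).
Proof.
intros HP.
assert (H0 : at_right 0 (fun x => 0 < x < 1)).
{ exists (mkposreal 1 Rlt_0_1); intros y Hy Hy0.
  change (Rabs (y - 0) < 1) in Hy; apply Rabs_def2 in Hy; lra. }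
assert (H1 : at_left 1 (fun x => 0 < x < 1)).
{ exists (mkposreal 1 Rlt_0_1); intros y Hy Hy0.
  change (Rabs (y - 1) < 1) in Hy; apply Rabs_def2 in Hy; lra. }
apply (Filter_prod _ _ _ _ _ H0 H1).
intros a b Ha Hb x; simpl; unfold Rmin, Rmax.
destruct (Rle_dec a b); intros Hx; apply HP; lra.
Qed.

Lemma is_RInt_gen_ext_01 {V : NormedModule R_AbsRing} (f g : R -> V) (l : V) :
  (forall t, 0 < t < 1 -> f t = g t) ->
  is_RInt_gen f (at_right 0) (at_left 1) l -> is_RInt_gen g (at_right 0) (at_left 1) l.
Proof.
intros Hfg; apply is_RInt_gen_ext.
generalize (unit_interval_filter _ Hfg); apply filter_imp.
intros ab H x Hx; apply H; lra.
Qed.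

(** The fundamental theorem applies on inner intervals, and continuity of [H] at 0 and 1 supplies
    the two limits. No derivative at the endpoints is asked for, as the extended antiderivative of
    an improper integrand may have none there. *)
Lemma is_RInt_gen_antiderivative_01 (h H : R -> R) :
  (forall t, 0 < t < 1 -> continuous h t) ->
  (forall t, 0 < t < 1 -> is_derive H t (h t)) ->
  (forall t, continuous H t) ->
  is_RInt_gen h (at_right 0) (at_left 1) (H 1 - H 0).
Proof.
intros Hh HD HC.
apply (is_RInt_gen_ext_01 (Derive H)).
{ intros t Ht; apply is_derive_unique, HD, Ht. }
apply is_RInt_gen_Derive.
- apply (unit_interval_filter (fun x => ex_derive H x)).
  intros t Ht; exists (h t); apply HD, Ht.
- apply (unit_interval_filter (fun x => continuous (Derive H) x)).
  intros t Ht; apply (continuous_ext_loc _ h); [|apply Hh, Ht].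
  generalize (locally_01 t Ht); apply filter_imp; intros y Hy.
  symmetry; apply is_derive_unique, HD, Hy.
- intros P HP; apply filter_le_within; apply HC, HP.
- intros P HP; apply filter_le_within; apply HC, HP.
Qed.

Lemma ex_RInt_01 (g : R -> R) (a b : R) :
  (forall t, 0 < t < 1 -> continuous g t) -> 0 < a < 1 -> 0 < b < 1 -> ex_RInt g a b.
Proof.
intros Hg Ha Hb; apply (ex_RInt_continuous (V := R_CompleteNormedModule)).
intros x; unfold Rmin, Rmax; destruct (Rle_dec a b); intros Hx; apply Hg; lra.
Qed.

(** With b near 1 fixed, F(b) - F(a) lies within eps/2 of [I] for every a near 0, so F satisfies the
    Cauchy criterion at 0; the argument at 1 is symmetric. The two limits extend F continuously. *)
Lemma continuous_antiderivative_01 (g : R -> R) (I : R) :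
  (forall t, 0 < t < 1 -> continuous g t) ->
  is_RInt_gen g (at_right 0) (at_left 1) I ->
  exists F : R -> R, (forall t, continuous F t) /\
    forall t, 0 < t < 1 -> is_derive F t (g t).
Proof.
intros Hg HI.
set (F := fun t => RInt g (1 / 2) t).
assert (HF : forall a b, 0 < a < 1 -> 0 < b < 1 -> F b - F a = RInt g a b).
{ intros a b Ha Hb; unfold F.
  rewrite <- (RInt_Chasles (V := R_CompleteNormedModule) g (1/2) a b);
    try (apply ex_RInt_01; auto; lra).
  unfold plus; simpl; ring. }
assert (HD : forall t, 0 < t < 1 -> is_derive F t (g t)).
{ intros t Ht; apply (is_derive_RInt (V := R_NormedModule) g F (1/2)); [|apply Hg, Ht].
  generalize (locally_01 t Ht); apply filter_imp; intros y Hy.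
  apply (RInt_correct (V := R_CompleteNormedModule)), ex_RInt_01; auto; lra. }
assert (HFI : forall eps : posreal, exists P Q : R -> Prop, at_right 0 P /\ at_left 1 Q /\
  forall a b, P a -> Q b -> (0 < a < 1) /\ (0 < b < 1) /\ Rabs (F b - F a - I) < eps).
{ intros eps.
  destruct (HI (ball I eps) (locally_ball I eps)) as [P Q HP HQ HPQ].
  (* Endpoints belong to the closed interval they span, so this places a and b themselves in
     (0,1). *)
  destruct (unit_interval_filter (fun t => 0 < t < 1) (fun t Ht => Ht)) as [P' Q' HP' HQ' HPQ'].
  exists (fun x => P x /\ P' x), (fun x => Q x /\ Q' x).
  split; [now apply filter_and|]; split; [now apply filter_and|].
  intros a b [Pa Pa'] [Qb Qb'].
  generalize (HPQ' a b Pa' Qb'); simpl; intros Hab.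
  assert (Ha : 0 < a < 1) by (apply Hab; split; [apply Rmin_l | apply Rmax_l]).
  assert (Hb : 0 < b < 1) by (apply Hab; split; [apply Rmin_r | apply Rmax_r]).
  split; [exact Ha|]; split; [exact Hb|].
  rewrite HF; trivial.
  destruct (HPQ a b Pa Qb) as [y [Hy HyI]]; simpl in Hy.
  rewrite (is_RInt_unique (V := R_CompleteNormedModule) _ _ _ _ Hy); exact HyI. }
assert (HA : exists A : R, filterlim F (at_right 0) (locally A)).
{ apply (filterlim_locally_cauchy (U := R_CompleteSpace)).
  intros eps; destruct (HFI (pos_div_2 eps)) as [P [Q [HP [HQ HPQ]]]].
  exists P; split; [exact HP|]; intros u v Hu Hv.
  destruct (filter_ex _ HQ) as [b Hb].
  destruct (HPQ u b Hu Hb) as [_ [_ H1]]; destruct (HPQ v b Hv Hb) as [_ [_ H2]].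
  simpl in H1, H2; apply Rabs_def2 in H1; apply Rabs_def2 in H2.
  change (Rabs (F v - F u) < eps); apply Rabs_def1; lra. }
assert (HB : exists B : R, filterlim F (at_left 1) (locally B)).
{ apply (filterlim_locally_cauchy (U := R_CompleteSpace)).
  intros eps; destruct (HFI (pos_div_2 eps)) as [P [Q [HP [HQ HPQ]]]].
  exists Q; split; [exact HQ|]; intros u v Hu Hv.
  destruct (filter_ex _ HP) as [a Ha].
  destruct (HPQ a u Ha Hu) as [_ [_ H1]]; destruct (HPQ a v Ha Hv) as [_ [_ H2]].
  simpl in H1, H2; apply Rabs_def2 in H1; apply Rabs_def2 in H2.
  change (Rabs (F v - F u) < eps); apply Rabs_def1; lra. }
destruct HA as [A HA]; destruct HB as [B HB].
destruct (C0_extension_lt F A B 0 1 Rlt_0_1) as [G [GC [GF _]]]; trivial.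
{ intros c Hc; apply (ex_derive_continuous F c); exists (g c); apply HD, Hc. }
exists G; split; [exact GC|].
(* The extension agrees with [F] near every interior point, so it inherits the derivative there. *)
intros t Ht; apply (is_derive_ext_loc F); [|apply HD, Ht].
generalize (locally_01 t Ht); apply filter_imp; intros y Hy.
symmetry; apply GF, Hy.
Qed.

(** * Integration by parts and termwise integration against real power series *)

Lemma is_RInt_gen_mult_by_parts_01 (g F phi dphi : R -> R) :
  (forall t, 0 < t < 1 -> continuous g t) ->
  (forall t, continuous F t) ->
  (forall t, 0 < t < 1 -> is_derive F t (g t)) ->
  (forall t, is_derive phi t (dphi t)) ->
  (forall t, continuous dphi t) ->
  is_RInt_gen (fun t => phi t * g t) (at_right 0) (at_left 1)
    (phi 1 * F 1 - phi 0 * F 0 - RInt (fun t => dphi t * F t) 0 1).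
Proof.
intros Hg HF HFd Hphi Hdphi.
assert (Hc : forall t, continuous (fun t => dphi t * F t) t).
{ intros t; apply (continuous_mult dphi F); auto. }
set (J := fun t => RInt (fun t => dphi t * F t) 0 t).
assert (HJ : forall t, is_derive J t (dphi t * F t)).
{ intros t; apply (is_derive_RInt (V := R_NormedModule) (fun t => dphi t * F t) J 0); [|apply Hc].
  apply filter_forall; intros y; apply (RInt_correct (V := R_CompleteNormedModule)).
  apply (ex_RInt_continuous (V := R_CompleteNormedModule)); intros; apply Hc. }
assert (Hphic : forall t, continuous phi t).
{ intros t; apply (ex_derive_continuous phi); exists (dphi t); apply Hphi. }
assert (HJ0 : J 0 = 0) by apply (RInt_point (V := R_CompleteNormedModule)).
change (RInt (fun t => dphi t * F t) 0 1) with (J 1).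
(* As J(0) = 0, the claimed value is the increment over [0,1] of phi F - J, an antiderivative of phi
   g on (0,1). *)
replace (phi 1 * F 1 - phi 0 * F 0 - J 1)
  with ((phi 1 * F 1 - J 1) - (phi 0 * F 0 - J 0)) by (rewrite HJ0; simpl; ring).
apply (is_RInt_gen_antiderivative_01 _ (fun t => phi t * F t - J t)).
- intros t Ht; apply (continuous_mult phi g); auto.
- intros t Ht.
  replace (phi t * g t) with ((dphi t * F t + phi t * g t) - dphi t * F t) by ring.
  apply (is_derive_minus (fun t => phi t * F t) J); [|apply HJ].
  apply (is_derive_mult phi F t (dphi t) (g t)); auto.
  intros; apply Rmult_comm.
- intros t; apply (continuous_minus (V := R_NormedModule) (fun t => phi t * F t) J).
  + apply (continuous_mult phi F); auto.
  + apply (ex_derive_continuous J); eexists; apply HJ.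
Qed.

(** On [0,1] the remainder of the power series is at most the tail of the sum of |d_n|, uniformly in
    t. Since F is bounded there, the integral of the remainder times F tends to 0. *)
Lemma is_series_RInt_PSeries_01 (d : nat -> R) (F : R -> R) :
  CV_radius d = p_infty -> (forall t, continuous F t) ->
  is_series (fun n => d n * RInt (fun t => t ^ n * F t) 0 1)
    (RInt (fun t => PSeries d t * F t) 0 1).
Proof.
intros Hd HF.
assert (Hpow : forall n t, continuous (fun t => t ^ n) t).
{ intros n t; apply (ex_derive_continuous (fun t => t ^ n)); auto_derive; trivial. }
assert (HI : forall n, ex_RInt (fun t => t ^ n * F t) 0 1).
{ intros n; apply (ex_RInt_continuous (V := R_CompleteNormedModule)); intros t _.
  apply (continuous_mult (fun t => t ^ n) F); auto. }
assert (HP : forall t, continuous (PSeries d) t).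
{ intros t; apply continuity_pt_filterlim, PSeries_continuity; rewrite Hd; exact I. }
assert (HPI : ex_RInt (fun t => PSeries d t * F t) 0 1).
{ apply (ex_RInt_continuous (V := R_CompleteNormedModule)); intros t _.
  apply (continuous_mult (PSeries d) F); auto. }
set (S := fun N t => sum_n (fun k => d k * t ^ k) N).
assert (HS : forall N, is_RInt (fun t => S N t * F t) 0 1
  (sum_n (fun n => d n * RInt (fun t => t ^ n * F t) 0 1) N)).
{ intros N; induction N as [|N IH].
  - rewrite sum_O.
    apply (is_RInt_ext (fun t => scal (d 0%nat) (t ^ 0 * F t))).
    { intros; unfold S; rewrite sum_O; unfold scal; simpl; unfold mult; simpl; ring. }
    apply (is_RInt_scal (V := R_NormedModule)), (RInt_correct (V := R_CompleteNormedModule)), HI.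
  - rewrite sum_Sn.
    apply (is_RInt_ext (fun t => plus (S N t * F t) (scal (d (Datatypes.S N)) (t ^ Datatypes.S N * F t)))).
    { intros; unfold S; rewrite sum_Sn; unfold plus, scal; simpl; unfold mult; simpl; ring. }
    apply (is_RInt_plus (V := R_NormedModule)); [exact IH|].
    apply (is_RInt_scal (V := R_NormedModule)), (RInt_correct (V := R_CompleteNormedModule)), HI. }
assert (Habs : ex_series (fun n => Rabs (d n))).
{ apply (ex_series_ext (fun n => Rabs (d n * 1 ^ n))).
  { intros n; rewrite pow1, Rmult_1_r; reflexivity. }
  apply CV_disk_inside; rewrite Hd; exact I. }
assert (Htail : forall N t, 0 <= t <= 1 ->
  Rabs (PSeries d t - S N t) <= Series (fun n => Rabs (d n)) - sum_n (fun n => Rabs (d n)) N).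
{ intros N t Ht.
  assert (Hle : forall n, Rabs (d n * t ^ n) <= Rabs (d n)).
  { intros n; rewrite Rabs_mult; apply Rle_trans with (Rabs (d n) * 1); [|lra].
    apply Rmult_le_compat_l; [apply Rabs_pos|].
    rewrite <- RPow_abs, <- (pow1 n); apply pow_incr.
    rewrite Rabs_pos_eq; lra. }
  assert (Hex : ex_series (fun n => Rabs (d n * t ^ n))).
  { apply (ex_series_le (V := R_CompleteNormedModule) _ (fun n => Rabs (d n))); [|exact Habs].
    intros n; unfold norm; simpl; unfold abs; simpl; rewrite Rabs_Rabsolu; apply Hle. }
  unfold PSeries, S.
  (* [sum_n] at N includes the term of index N, so both series are split at N + 1 and only their
     tails remain. *)
  rewrite (Series_incr_n (fun n => d n * t ^ n) (Datatypes.S N));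
    [|lia|apply ex_series_Rabs, Hex].
  rewrite (Series_incr_n (fun n => Rabs (d n)) (Datatypes.S N)); [|lia|exact Habs].
  rewrite !sum_n_Reals; simpl pred.
  match goal with |- Rabs (?x + ?y - ?x) <= _ => replace (x + y - x) with y by ring end.
  match goal with |- _ <= ?x + ?y - ?x => replace (x + y - x) with y by ring end.
  apply Rle_trans with (Series (fun k => Rabs (d (Datatypes.S N + k)%nat * t ^ (Datatypes.S N + k)))).
  - apply Series_Rabs.
    apply (ex_series_incr_n (fun n => Rabs (d n * t ^ n)) (Datatypes.S N)), Hex.
  - apply Series_le.
    + intros n; split; [apply Rabs_pos | apply Hle].
    + apply (ex_series_incr_n (fun n => Rabs (d n)) (Datatypes.S N)), Habs. }
destruct (continuity_ab_maj (fun t => Rabs (F t)) 0 1) as [m [Hm _]]; [lra| |].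
{ intros c _; apply (continuity_pt_comp F Rabs); [apply continuity_pt_filterlim, HF | apply Rcontinuity_abs]. }
set (M := Rabs (F m)) in Hm.
change (is_lim_seq (sum_n (fun n => d n * RInt (fun t => t ^ n * F t) 0 1))
  (RInt (fun t => PSeries d t * F t) 0 1)).
set (T := fun N => Series (fun n => Rabs (d n)) - sum_n (fun n => Rabs (d n)) N).
assert (HT : is_lim_seq (fun N => T N * M) 0).
{ replace (Finite 0) with (Rbar_mult (Finite 0) (Finite M)) by (simpl; f_equal; ring).
  apply is_lim_seq_scal_r.
  replace (Finite 0) with (Finite (Series (fun n => Rabs (d n)) - Series (fun n => Rabs (d n))))
    by (f_equal; ring).
  apply is_lim_seq_minus'; [apply is_lim_seq_const|].
  exact (Series_correct _ Habs). }
apply (is_lim_seq_ext (fun N => RInt (fun t => PSeries d t * F t) 0 1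
  - RInt (fun t => (PSeries d t - S N t) * F t) 0 1)).
{ intros N.
  rewrite <- (is_RInt_unique (V := R_CompleteNormedModule) _ _ _ _ (HS N)).
  rewrite (RInt_ext (fun t => (PSeries d t - S N t) * F t) (fun t => minus (PSeries d t * F t) (S N t * F t))).
  - rewrite (RInt_minus (V := R_CompleteNormedModule)).
    + unfold minus, plus, opp; simpl; ring.
    + exact HPI.
    + eexists; apply HS.
  - intros; unfold minus, plus, opp; simpl; ring. }
replace (RInt (fun t => PSeries d t * F t) 0 1)
  with (RInt (fun t => PSeries d t * F t) 0 1 - 0) at 1 by ring.
apply is_lim_seq_minus'; [apply is_lim_seq_const|].
apply is_lim_seq_abs_0.
apply (is_lim_seq_le_le (fun _ => 0) _ (fun N => T N * M)); [|apply is_lim_seq_const|exact HT].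
intros N; split; [apply Rabs_pos|].
(* The inserted factor 1 = 1 - 0 is the length of the interval in the estimate by length times
   maximum. *)
rewrite <- (Rmult_1_l (T N * M)).
replace 1 with (1 - 0) at 2 by ring.
apply abs_RInt_le_const; [lra| |].
- apply (ex_RInt_ext (fun t => minus (PSeries d t * F t) (S N t * F t))).
  + intros; unfold minus, plus, opp; simpl; ring.
  + apply (ex_RInt_minus (V := R_NormedModule)); [exact HPI | eexists; apply HS].
- intros t Ht; rewrite Rabs_mult; apply Rmult_le_compat; try apply Rabs_pos.
  + apply Htail, Ht.
  + apply Hm, Ht.
Qed.

(** The moments [J] are chosen before the coefficients [c], so that the same moments serve for the
    real and for the imaginary parts of the coefficients of exp(zt). *)
Lemma is_RInt_gen_PSeries_mult_01 (g : R -> R) (I : R) :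
  (forall t, 0 < t < 1 -> continuous g t) ->
  is_RInt_gen g (at_right 0) (at_left 1) I ->
  exists J : nat -> R,
    (forall n, is_RInt_gen (fun t => t ^ n * g t) (at_right 0) (at_left 1) (J n)) /\
    forall c : nat -> R, CV_radius c = p_infty -> exists L : R,
      is_RInt_gen (fun t => PSeries c t * g t) (at_right 0) (at_left 1) L /\
      is_series (fun n => c n * J n) L.
Proof.
intros Hg HI.
destruct (continuous_antiderivative_01 g I Hg HI) as [F [HF HFd]].
set (K := fun n => RInt (fun t => (INR n * t ^ pred n) * F t) 0 1).
(* The value given by parts with phi(t) = t^n. Since [0 ^ 0] is 1, the lower boundary terms sum to
   phi(0) F(0) with phi(0) = c_0. *)
exists (fun n => 1 ^ n * F 1 - 0 ^ n * F 0 - K n); split.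
{ intros n; apply (is_RInt_gen_mult_by_parts_01 g F (fun t => t ^ n)
    (fun t => INR n * t ^ pred n)); trivial; intros t.
  - auto_derive; trivial; ring.
  - apply (ex_derive_continuous (fun t => INR n * t ^ pred n)); auto_derive; trivial. }
intros c Hc.
assert (Hdc : CV_radius (PS_derive c) = p_infty) by (rewrite CV_radius_derive; exact Hc).
eexists; split.
{ apply (is_RInt_gen_mult_by_parts_01 g F (PSeries c) (PSeries (PS_derive c))); trivial; intros t.
  - apply is_derive_PSeries; rewrite Hc; exact Logic.I.
  - apply continuity_pt_filterlim, PSeries_continuity; rewrite Hdc; exact Logic.I. }
assert (HP : forall x, is_series (fun n => c n * x ^ n) (PSeries c x)).
{ intros x; apply Series_correct, ex_series_Rabs, CV_disk_inside; rewrite Hc; exact Logic.I. }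
assert (HK : is_series (fun n => c n * K n) (RInt (fun t => PSeries (PS_derive c) t * F t) 0 1)).
(* The factor [INR 0] kills the term n = 0. Shifting the index by one then turns the coefficients
   into those of [PS_derive c]. *)
{ assert (HK0 : K 0%nat = 0).
  { unfold K; rewrite (RInt_ext _ (fun _ => 0)).
    - rewrite RInt_const; unfold scal; simpl; unfold mult; simpl; ring.
    - intros; simpl; ring. }
  apply is_series_decr_1; rewrite HK0.
  match goal with |- is_series _ (plus ?l _) => replace (plus l _) with l end.
  2:{ unfold plus, opp; simpl; rewrite Rmult_0_r, Ropp_0, Rplus_0_r; reflexivity. }
  apply (is_series_ext (fun n => PS_derive c n * RInt (fun t => t ^ n * F t) 0 1));
    [|apply is_series_RInt_PSeries_01; trivial].
  intros n; unfold K, PS_derive.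
  rewrite (RInt_ext (fun t => INR (S n) * t ^ pred (S n) * F t)
    (fun t => scal (INR (S n)) (t ^ n * F t))).
  - rewrite (RInt_scal (V := R_CompleteNormedModule)).
    + unfold scal; simpl; unfold mult; simpl; ring.
    + apply (ex_RInt_continuous (V := R_CompleteNormedModule)); intros t _.
      apply (continuous_mult (fun t => t ^ n) F); auto.
      apply (ex_derive_continuous (fun t => t ^ n)); auto_derive; trivial.
  - intros; simpl pred; unfold scal; simpl; unfold mult; simpl; ring. }
apply (is_series_ext (fun n => minus (minus (scal (F 1) (c n * 1 ^ n)) (scal (F 0) (c n * 0 ^ n))) (c n * K n))).
{ intros n; unfold minus, plus, opp, scal; simpl; unfold mult; simpl; ring. }
rewrite !(Rmult_comm (PSeries c _)).
apply (is_series_minus (V := R_NormedModule)); [|exact HK].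
apply (is_series_minus (V := R_NormedModule)); apply (is_series_scal (V := R_NormedModule)), HP.
Qed.

(** Beyond a finite radius the terms cannot tend to 0, so even conditional convergence at points of
    arbitrarily large modulus excludes a finite radius. *)
Lemma CV_radius_infinite (c : nat -> R) :
  (forall M, exists x, M < Rabs x /\ ex_series (fun n => c n * x ^ n)) ->
  CV_radius c = p_infty.
Proof.
intros H; generalize (CV_radius_ge_0 c); case_eq (CV_radius c); simpl; trivial; [|tauto].
intros r Hr _; exfalso.
destruct (H r) as [x [Hx Hex]].
apply (CV_disk_outside c x); [rewrite Hr; exact Hx | exact (ex_series_lim_0 _ Hex)].
Qed.

(** * Complex series and integrals through real and imaginary parts; reflection of the interval *)

Lemma sum_n_pair (a : nat -> C) (N : nat) :
  @sum_n C_AbelianMonoid a N = (sum_n (fun n => Re (a n)) N, sum_n (fun n => Im (a n)) N).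
Proof.
induction N as [|N IH]; [rewrite !sum_O | rewrite !sum_Sn, IH].
- destruct (a 0%nat); reflexivity.
- destruct (a (S N)); reflexivity.
Qed.

(** Balls of [C_UniformSpace] are products of real balls, so it is enough that both parts are
    eventually close. *)
Lemma is_Cseries_pair (a : nat -> C) (l : C) :
  is_series (fun n => Re (a n)) (Re l) -> is_series (fun n => Im (a n)) (Im l) ->
  @is_series C_AbsRing C_NormedModule a l.
Proof.
intros H1 H2 P [eps HP].
assert (Hre : Hierarchy.eventually (fun N => ball (Re l) eps (sum_n (fun n => Re (a n)) N)))
  by exact (H1 _ (locally_ball _ eps)).
assert (Him : Hierarchy.eventually (fun N => ball (Im l) eps (sum_n (fun n => Im (a n)) N)))
  by exact (H2 _ (locally_ball _ eps)).
change (Hierarchy.eventually (fun N => P (@sum_n C_AbelianMonoid a N))).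
generalize (filter_and _ _ Hre Him); apply filter_imp; intros N HN; apply HP.
change (@ball C_UniformSpace l eps (@sum_n C_AbelianMonoid a N)).
rewrite sum_n_pair; exact HN.
Qed.

Lemma is_Cseries_parts (a : nat -> C) (l : C) :
  @is_series C_AbsRing C_NormedModule a l ->
  is_series (fun n => Re (a n)) (Re l) /\ is_series (fun n => Im (a n)) (Im l).
Proof.
intros Hl.
assert (Hb : forall eps : posreal, Hierarchy.eventually (fun N =>
  ball (Re l) eps (sum_n (fun n => Re (a n)) N) /\
  ball (Im l) eps (sum_n (fun n => Im (a n)) N))).
{ intros eps; generalize (Hl _ (locally_ball (T := C_UniformSpace) l eps)).
  unfold filtermap; apply filter_imp.
  intros N HN; change (@ball C_UniformSpace l eps (@sum_n C_AbelianMonoid a N)) in HN.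
  rewrite sum_n_pair in HN; exact HN. }
split; intros P [eps HP];
  unfold filtermap; generalize (Hb eps); apply filter_imp; intros N [H1 H2]; apply HP; assumption.
Qed.

Lemma Cseries_unique (a : nat -> C) (l : C) :
  @is_series C_AbsRing C_NormedModule a l -> Cseries a = l.
Proof.
intros H; destruct (is_Cseries_parts a l H) as [H1 H2]; unfold Cseries.
rewrite (is_series_unique _ _ H1), (is_series_unique _ _ H2); destruct l; reflexivity.
Qed.

Lemma is_RInt_gen_Re {Fa Fb : (R -> Prop) -> Prop} {FFa : Filter Fa} {FFb : Filter Fb}
    (f : R -> C) (l : C) :
  @is_RInt_gen C_R_NormedModule f Fa Fb l -> is_RInt_gen (fun t => Re (f t)) Fa Fb (Re l).
Proof.
intros H P [eps HP].
assert (HQ : @locally C_UniformSpace l (fun c => P (Re c))).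
{ exists eps; intros y [Hy _]; apply HP, Hy. }
generalize (H _ HQ); unfold filtermapi; apply filter_imp; intros ab [y [Hy HyP]].
exists (Re y); split; [exact (is_RInt_fct_extend_fst f _ _ y Hy) | exact HyP].
Qed.

Lemma is_RInt_gen_Im {Fa Fb : (R -> Prop) -> Prop} {FFa : Filter Fa} {FFb : Filter Fb}
    (f : R -> C) (l : C) :
  @is_RInt_gen C_R_NormedModule f Fa Fb l -> is_RInt_gen (fun t => Im (f t)) Fa Fb (Im l).
Proof.
intros H P [eps HP].
assert (HQ : @locally C_UniformSpace l (fun c => P (Im c))).
{ exists eps; intros y [_ Hy]; apply HP, Hy. }
generalize (H _ HQ); unfold filtermapi; apply filter_imp; intros ab [y [Hy HyP]].
exists (Im y); split; [exact (is_RInt_fct_extend_snd f _ _ y Hy) | exact HyP].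
Qed.

Lemma is_RInt_gen_pair {Fa Fb : (R -> Prop) -> Prop} {FFa : Filter Fa} {FFb : Filter Fb}
    (f : R -> C) (l : C) :
  is_RInt_gen (fun t => Re (f t)) Fa Fb (Re l) ->
  is_RInt_gen (fun t => Im (f t)) Fa Fb (Im l) ->
  @is_RInt_gen C_R_NormedModule f Fa Fb l.
Proof.
intros H1 H2 P [eps HP].
generalize (H1 _ (locally_ball _ eps)) (H2 _ (locally_ball _ eps)).
unfold filtermapi; intros K1 K2; generalize (filter_and _ _ K1 K2).
apply filter_imp; intros ab [[y1 [Hy1 B1]] [y2 [Hy2 B2]]].
exists (y1, y2); split.
- exact (is_RInt_fct_extend_pair f _ _ y1 y2 Hy1 Hy2).
- apply HP; split; assumption.
Qed.

(** The map t -> 1 - t exchanges the filters at 0 and at 1, and the resulting change of orientation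
    cancels its derivative -1. *)
Lemma is_RInt_gen_reflect_01 {V : NormedModule R_AbsRing} (f : R -> V) (l : V) :
  is_RInt_gen f (at_right 0) (at_left 1) l ->
  is_RInt_gen (fun t => f (1 - t)) (at_right 0) (at_left 1) l.
Proof.
intros H P HP.
destruct (H P HP) as [A B [d1 HA] [d2 HB] HAB].
apply (Filter_prod _ _ _ (fun a => B (1 - a)) (fun b => A (1 - b))).
- exists d2; intros y Hy Hy0; apply HB; [|lra].
  change (Rabs (1 - y - 1) < d2); change (Rabs (y - 0) < d2) in Hy.
  apply Rabs_def2 in Hy; apply Rabs_def1; lra.
- exists d1; intros y Hy Hy1; apply HA; [|lra].
  change (Rabs (1 - y - 0) < d1); change (Rabs (y - 1) < d1) in Hy.
  apply Rabs_def2 in Hy; apply Rabs_def1; lra.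
- intros a b HBa HAb; destruct (HAB _ _ HAb HBa) as [y [Hy HyP]]; simpl in Hy.
  exists y; split; [|exact HyP]; simpl.
  (* The integrand is put in the form required by the affine substitution with slope -1 and offset
     1; the outer [opp] matches the sign from [is_RInt_swap]. *)
  apply (is_RInt_ext (fun t => opp (scal (-1) (f (-1 * t + 1))))).
  { intros x _; replace (-1 * x + 1) with (1 - x) by ring.
    change (opp (scal (opp one) (f (1 - x))) = f (1 - x)).
    rewrite scal_opp_one; apply opp_opp. }
  rewrite <- (opp_opp y).
  apply is_RInt_opp, is_RInt_comp_lin, is_RInt_swap.
  replace (-1 * b + 1) with (1 - b) by ring; replace (-1 * a + 1) with (1 - a) by ring.
  exact Hy.
Qed.

(** * The power series of exp(zt) in the real variable t *)

Definition expcoef (z : C) (n : nat) : C := (Cpow z n / RtoC (INR (fact n)))%C.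

Lemma expcoef_scal (z : C) (n : nat) :
  expcoef z n = (/ INR (fact n) * Re (Cpow z n), / INR (fact n) * Im (Cpow z n)).
Proof.
unfold expcoef, Cdiv; rewrite <- RtoC_inv by apply INR_fact_neq_0.
destruct (Cpow z n) as [u v]; unfold Cmult, RtoC; simpl; f_equal; ring.
Qed.

(** Real and imaginary parts are dominated by the moduli |z|^n / n!, whose power series is a real
    exponential and converges everywhere. *)
Lemma expcoef_CV (z : C) :
  CV_radius (fun n => Re (expcoef z n)) = p_infty /\
  CV_radius (fun n => Im (expcoef z n)) = p_infty.
Proof.
assert (Hex : forall x, ex_series (fun n => Cmod (expcoef z n) * Rabs x ^ n)).
{ intros x; exists (exp (Cmod z * Rabs x)).
  apply (is_series_ext (fun n => scal (pow_n (Cmod z * Rabs x) n) (/ INR (fact n)))).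
  - intros n; rewrite pow_n_pow; unfold scal; simpl; unfold mult; simpl.
    unfold expcoef; rewrite Cmod_div, Cmod_pow, Cmod_R.
    + rewrite (Rabs_pos_eq (INR (fact n))) by apply pos_INR; rewrite Rpow_mult_distr.
      unfold Rdiv; ring.
    + intros E; apply RtoC_inj in E; exact (INR_fact_neq_0 n E).
  - exact (is_exp_Reals (Cmod z * Rabs x)). }
split; apply CV_radius_infinite; intros M; exists (Rabs M + 1);
  (split; [rewrite Rabs_pos_eq; [generalize (Rle_abs M); lra | generalize (Rabs_pos M); lra]|]);
  refine (ex_series_le (V := R_CompleteNormedModule) _ _ _ (Hex (Rabs M + 1)));
  intros n; match goal with |- norm ?u <= _ => change (norm u) with (Rabs u) end;
  rewrite Rabs_mult, RPow_abs;
  apply Rmult_le_compat_r; try apply Rabs_pos.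
- apply re_le_Cmod.
- apply Rle_trans with (2 := Rmax_Cmod _); apply Rmax_r.
Qed.

(* Both sides solve the linear system u' = x u - y v, v' = y u + x v. *)
Lemma Cexp_PSeries (z : C) (t : R) :
  Cexp (z * RtoC t)
  = (PSeries (fun n => Re (expcoef z n)) t, PSeries (fun n => Im (expcoef z n)) t).
Proof.
destruct (expcoef_CV z) as [Ha Hb].
set (a := fun n => Re (expcoef z n)) in *; set (b := fun n => Im (expcoef z n)) in *.
set (x := Re z); set (y := Im z).
(* Real and imaginary parts of (n+1) c_{n+1} = z c_n, where c_n = z^n / n!. *)
assert (Hrec : forall n, PS_derive a n = x * a n - y * b n /\ PS_derive b n = y * a n + x * b n).
{ intros n; unfold PS_derive, a, b; rewrite !expcoef_scal.
  rewrite fact_simpl, mult_INR, Cpow_S.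
  assert (INR (S n) <> 0) by (apply not_0_INR; lia).
  generalize (INR_fact_neq_0 n); intros.
  destruct (Cpow z n) as [u v]; unfold x, y, Re, Im, Cmult; cbn [fst snd].
  split; field; auto. }
assert (Hexa : forall s, ex_pseries a s) by (intros s; apply CV_radius_inside; rewrite Ha; exact I).
assert (Hexb : forall s, ex_pseries b s) by (intros s; apply CV_radius_inside; rewrite Hb; exact I).
assert (Hda : forall s, is_derive (PSeries a) s (x * PSeries a s - y * PSeries b s)).
{ intros s; replace (x * PSeries a s - y * PSeries b s) with (PSeries (PS_derive a) s).
  - apply is_derive_PSeries; rewrite Ha; exact I.
  - rewrite <- !PSeries_scal, <- PSeries_minus;
      try (apply ex_pseries_scal; auto; intros; apply Rmult_comm).
    apply PSeries_ext; intros n; rewrite (proj1 (Hrec n)).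
    unfold PS_minus, PS_plus, PS_opp, PS_scal, plus, opp, scal; simpl; unfold mult; simpl; ring. }
assert (Hdb : forall s, is_derive (PSeries b) s (y * PSeries a s + x * PSeries b s)).
{ intros s; replace (y * PSeries a s + x * PSeries b s) with (PSeries (PS_derive b) s).
  - apply is_derive_PSeries; rewrite Hb; exact I.
  - rewrite <- !PSeries_scal, <- PSeries_plus;
      try (apply ex_pseries_scal; auto; intros; apply Rmult_comm).
    apply PSeries_ext; intros n; rewrite (proj2 (Hrec n)).
    unfold PS_plus, PS_scal, plus, scal; simpl; unfold mult; simpl; ring. }
assert (Hconst : forall h : R -> R, (forall s, is_derive h s 0) -> h t = h 0).
{ intros h Hh.
  destruct (MVT_gen h 0 t (fun _ => 0)) as [c [_ Hc]].
  - intros s _; apply Hh.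
  - intros s _; apply continuity_pt_filterlim, (ex_derive_continuous h); exists 0; apply Hh.
  - lra. }
set (u := PSeries a) in *; set (v := PSeries b) in *.
assert (Hu0 : u 0 = 1).
{ unfold u; rewrite PSeries_0; unfold a; rewrite expcoef_scal; simpl; field. }
assert (Hv0 : v 0 = 0).
{ unfold v; rewrite PSeries_0; unfold b; rewrite expcoef_scal; simpl; field. }
(* These are the real and imaginary parts of exp(-zs) (u + iv). The linear system makes their
   derivatives vanish, so they keep their values 1 and 0 at s = 0. *)
assert (H1 := Hconst (fun s => exp (- (x * s)) * (cos (y * s) * u s + sin (y * s) * v s))).
assert (H2 := Hconst (fun s => exp (- (x * s)) * (cos (y * s) * v s - sin (y * s) * u s))).
cbv beta in H1, H2; rewrite Hu0, Hv0, (Rmult_0_r x), (Rmult_0_r y), Ropp_0, exp_0, cos_0, sin_0 in H1, H2.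
assert (E1 : exp (- (x * t)) * (cos (y * t) * u t + sin (y * t) * v t) = 1).
{ rewrite H1; [ring|]; intros s; auto_derive.
  - repeat split; eexists; [apply Hda | apply Hdb].
  - rewrite (is_derive_unique (fun s : R => u s) _ _ (Hda s)),
      (is_derive_unique (fun s : R => v s) _ _ (Hdb s)); ring. }
assert (E2 : exp (- (x * t)) * (cos (y * t) * v t - sin (y * t) * u t) = 0).
{ rewrite H2; [ring|]; intros s; auto_derive.
  - repeat split; eexists; [apply Hdb | apply Hda].
  - rewrite (is_derive_unique (fun s : R => u s) _ _ (Hda s)),
      (is_derive_unique (fun s : R => v s) _ _ (Hdb s)); ring. }
assert (Hsc := sin2_cos2 (y * t)); unfold Rsqr in Hsc.
assert (Hee : exp (x * t) * exp (- (x * t)) = 1).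
{ rewrite <- exp_plus, Rplus_opp_r; apply exp_0. }
assert (Hz : (z * RtoC t)%C = (x * t, y * t)).
{ unfold x, y; destruct z; unfold Cmult, RtoC, Re, Im; simpl; f_equal; ring. }
unfold Cexp; rewrite Hz; simpl Re; simpl Im.
(* Inserting exp(xt) exp(-xt) = 1 and sin^2 + cos^2 = 1 expands w into the terms that appear when
   [E1] and [E2] are solved for u and v. *)
assert (Ht : forall w, w = exp (x * t) * (cos (y * t) * (exp (- (x * t)) * (cos (y * t) * w))
  + sin (y * t) * (exp (- (x * t)) * (sin (y * t) * w)))).
{ intros w; transitivity ((exp (x * t) * exp (- (x * t)))
    * (sin (y * t) * sin (y * t) + cos (y * t) * cos (y * t)) * w); [rewrite Hee, Hsc|]; ring. }
f_equal.
- rewrite <- (Rmult_1_r (cos (y * t))), <- E1.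
  transitivity (exp (x * t) * (cos (y * t) * (exp (- (x * t)) * (cos (y * t) * u t + sin (y * t) * v t))
    - sin (y * t) * (exp (- (x * t)) * (cos (y * t) * v t - sin (y * t) * u t)))).
  + rewrite E2; ring.
  + rewrite (Ht (u t)) at 3; ring.
- rewrite <- (Rmult_1_r (sin (y * t))), <- E1.
  transitivity (exp (x * t) * (sin (y * t) * (exp (- (x * t)) * (cos (y * t) * u t + sin (y * t) * v t))
    + cos (y * t) * (exp (- (x * t)) * (cos (y * t) * v t - sin (y * t) * u t)))).
  + rewrite E2; ring.
  + rewrite (Ht (v t)) at 3; ring.
Qed.

(** * Continuity of the M-beta integrand, part by part *)

Definition continuous_parts (f : R -> C) (t : R) : Prop :=
  continuous (fun s => Re (f s)) t /\ continuous (fun s => Im (f s)) t.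

Lemma continuous_parts_mult (f g : R -> C) (t : R) :
  continuous_parts f t -> continuous_parts g t ->
  continuous_parts (fun s => (f s * g s)%C) t.
Proof.
intros [F1 F2] [G1 G2]; split.
- apply (continuous_minus (V := R_NormedModule) (fun s => Re (f s) * Re (g s)) (fun s => Im (f s) * Im (g s))).
  + apply (continuous_mult (fun s => Re (f s)) (fun s => Re (g s))); auto.
  + apply (continuous_mult (fun s => Im (f s)) (fun s => Im (g s))); auto.
- apply (continuous_plus (V := R_NormedModule) (fun s => Re (f s) * Im (g s)) (fun s => Im (f s) * Re (g s))).
  + apply (continuous_mult (fun s => Re (f s)) (fun s => Im (g s))); auto.
  + apply (continuous_mult (fun s => Im (f s)) (fun s => Re (g s))); auto.
Qed.

Lemma continuous_parts_Rcpow (s : C) (t : R) : 0 < t -> continuous_parts (fun u => Rcpow u s) t.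
Proof.
intros Ht; split; apply (ex_derive_continuous (V := R_NormedModule));
  unfold Rcpow, Cexp, Cmult, RtoC, Re, Im; simpl; auto_derive; auto.
Qed.

Lemma continuous_parts_Rcpow_compl (s : C) (t : R) :
  t < 1 -> continuous_parts (fun u => Rcpow (1 - u) s) t.
Proof.
intros Ht; split; apply (ex_derive_continuous (V := R_NormedModule));
  unfold Rcpow, Cexp, Cmult, RtoC, Re, Im; simpl; auto_derive; repeat split; lra.
Qed.

Lemma Re_RtoC_mult (r : R) (w : C) : Re (RtoC r * w) = r * Re w.
Proof. unfold Cmult, RtoC, Re, Im; cbn [fst snd]; ring. Qed.

Lemma Im_RtoC_mult (r : R) (w : C) : Im (RtoC r * w) = r * Im w.
Proof. unfold Cmult, RtoC, Re, Im; cbn [fst snd]; ring. Qed.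

(** Homogeneity of degree m under real scaling makes the M-series along a ray a power series in the
    real parameter. *)
Lemma Mterm_mult_R (kappa mu : list C) (alpha beta w : C) (r : R) (m : nat) :
  Mterm kappa mu alpha beta (w * RtoC r) m
  = (RtoC (r ^ m) * Mterm kappa mu alpha beta w m)%C.
Proof.
unfold Mterm; rewrite Cpow_mult_l, RtoC_pow; ring.
Qed.

Lemma Marg_mult (rho : C) (t : R) :
  0 < t < 1 -> Marg rho t = (- rho * RtoC (/ (t * (1 - t))))%C.
Proof.
intros Ht; unfold Marg, Cdiv; rewrite RtoC_inv; [reflexivity|].
apply Rgt_not_eq, Rmult_lt_0_compat; lra.
Qed.

(* Along the ray -rho s, s > 0, the M-series is a pair of real power series in s;
   both have infinite radius because 1/(t(1-t)) is unbounded on (0,1). *)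
Lemma continuous_parts_Mseries (kappa mu : list C) (alpha beta rho : C) (t : R) :
  (forall t, 0 < t < 1 -> ex_Mseries kappa mu alpha beta (Marg rho t)) ->
  0 < t < 1 ->
  continuous_parts (fun t => Mseries kappa mu alpha beta (Marg rho t)) t.
Proof.
intros Hex Ht.
set (a := fun m => Re (Mterm kappa mu alpha beta (- rho) m)).
set (b := fun m => Im (Mterm kappa mu alpha beta (- rho) m)).
set (s := fun t => / (t * (1 - t))).
assert (Hterm : forall t m, 0 < t < 1 ->
  Re (Mterm kappa mu alpha beta (Marg rho t) m) = a m * s t ^ m /\
  Im (Mterm kappa mu alpha beta (Marg rho t) m) = b m * s t ^ m).
{ intros u m Hu; rewrite Marg_mult, Mterm_mult_R by exact Hu.
  rewrite Re_RtoC_mult, Im_RtoC_mult; split; apply Rmult_comm. }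
assert (Hab : forall t, 0 < t < 1 ->
  ex_series (fun m => a m * s t ^ m) /\ ex_series (fun m => b m * s t ^ m)).
{ intros u Hu; destruct (Hex u Hu) as [l Hl]; apply is_Cseries_parts in Hl.
  destruct Hl as [H1 H2]; split.
  - exists (Re l); exact (is_series_ext _ _ _ (fun m => proj1 (Hterm u m Hu)) H1).
  - exists (Im l); exact (is_series_ext _ _ _ (fun m => proj2 (Hterm u m Hu)) H2). }
assert (Hs : forall M, exists t, 0 < t < 1 /\ M < Rabs (s t)).
{ intros M; generalize (Rabs_pos M) (Rle_abs M); intros HM0 HM.
  (* The summand 2 ensures K > 1, so t = 1/K lies in (0,1), and 1/(t(1-t)) >= 1/t = K > M. *)
  set (K := Rabs M + 2); exists (/ K).
  assert (HK : 0 < / K < 1).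
  { split; [apply Rinv_0_lt_compat; unfold K; lra|].
    rewrite <- Rinv_1; apply Rinv_lt_contravar; unfold K; lra. }
  split; [exact HK|].
  apply Rlt_le_trans with K; [unfold K; lra|].
  apply Rle_trans with (2 := Rle_abs _); unfold s.
  rewrite <- (Rinv_inv K) at 1; apply Rinv_le_contravar.
  - apply Rmult_lt_0_compat; lra.
  - assert (0 <= / K * / K) by (apply Rmult_le_pos; lra); lra. }
assert (Ha : CV_radius a = p_infty).
{ apply CV_radius_infinite; intros M; destruct (Hs M) as [u [Hu HM]].
  exists (s u); split; [exact HM | apply Hab, Hu]. }
assert (Hb : CV_radius b = p_infty).
{ apply CV_radius_infinite; intros M; destruct (Hs M) as [u [Hu HM]].
  exists (s u); split; [exact HM | apply Hab, Hu]. }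
assert (Hsc : continuous s t).
{ apply (ex_derive_continuous s); unfold s; auto_derive.
  apply Rgt_not_eq, Rmult_lt_0_compat; lra. }
assert (HP : forall c, CV_radius c = p_infty -> continuous (fun t => PSeries c (s t)) t).
{ intros c Hc; apply (continuous_comp s (PSeries c)); [exact Hsc|].
  apply continuity_pt_filterlim, PSeries_continuity; rewrite Hc; exact I. }
split.
- apply (continuous_ext_loc _ (fun t => PSeries a (s t))); [|apply HP, Ha].
  generalize (locally_01 t Ht); apply filter_imp; intros u Hu.
  unfold PSeries; apply Series_ext; intros m; symmetry; apply Hterm, Hu.
- apply (continuous_ext_loc _ (fun t => PSeries b (s t))); [|apply HP, Hb].
  generalize (locally_01 t Ht); apply filter_imp; intros u Hu.
  unfold PSeries; apply Series_ext; intros m; symmetry; apply Hterm, Hu.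
Qed.

(** * Complex powers and complex integrals weighted by exp(zt) *)

Lemma Cexp_plus (z w : C) : Cexp (z + w) = (Cexp z * Cexp w)%C.
Proof.
unfold Cexp, Cmult, Cplus, Re, Im; simpl.
rewrite exp_plus, cos_plus, sin_plus; f_equal; ring.
Qed.

Lemma Rcpow_plus_INR (t : R) (s : C) (n : nat) :
  0 < t -> Rcpow t (s + RtoC (INR n)) = (RtoC (t ^ n) * Rcpow t s)%C.
Proof.
intros Ht; assert (Hn : Cexp (RtoC (INR n) * RtoC (ln t)) = RtoC (t ^ n)).
{ rewrite <- RtoC_mult, <- Rpower_pow by exact Ht.
  unfold Cexp, Rpower, RtoC, Re, Im; cbn [fst snd]; rewrite cos_0, sin_0.
  apply injective_projections; cbn [fst snd]; ring. }
unfold Rcpow; rewrite Cmult_plus_distr_r, Cexp_plus, Hn; apply Cmult_comm.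
Qed.

Lemma is_RInt_gen_C_ext_01 (f g : R -> C) (l : C) :
  (forall t, 0 < t < 1 -> f t = g t) ->
  @is_RInt_gen C_R_NormedModule f (at_right 0) (at_left 1) l ->
  @is_RInt_gen C_R_NormedModule g (at_right 0) (at_left 1) l.
Proof.
exact (is_RInt_gen_ext_01 (V := C_R_NormedModule) f g l).
Qed.

Lemma int01_unique (f : R -> C) (l : C) :
  @is_RInt_gen C_R_NormedModule f (at_right 0) (at_left 1) l -> int01 f = l.
Proof.
exact (is_RInt_gen_unique (V := C_R_CompleteNormedModule) f l).
Qed.

(** The product of exp(zt) and g splits into four real products, each handled by the real exchange
    of sum and integral. The two families of real moments pair up to the complex moments, and the
    four limits recombine by the rule for complex multiplication. *)
Lemma is_RInt_gen_Cexp_mult_01 (g : R -> C) (z I : C) :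
  (forall t, 0 < t < 1 -> continuous_parts g t) ->
  @is_RInt_gen C_R_NormedModule g (at_right 0) (at_left 1) I ->
  exists (J : nat -> C) (L : C),
    (forall n, @is_RInt_gen C_R_NormedModule (fun t => (RtoC (t ^ n) * g t)%C)
       (at_right 0) (at_left 1) (J n)) /\
    @is_RInt_gen C_R_NormedModule (fun t => (Cexp (z * RtoC t) * g t)%C)
      (at_right 0) (at_left 1) L /\
    @is_series C_AbsRing C_NormedModule (fun n => (expcoef z n * J n)%C) L.
Proof.
intros Hg HI.
destruct (expcoef_CV z) as [Ha Hb].
destruct (is_RInt_gen_PSeries_mult_01 (fun t => Re (g t)) (Re I)) as [J1 [HJ1 HS1]].
{ intros t Ht; apply Hg, Ht. }
{ apply is_RInt_gen_Re, HI. }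
destruct (is_RInt_gen_PSeries_mult_01 (fun t => Im (g t)) (Im I)) as [J2 [HJ2 HS2]].
{ intros t Ht; apply Hg, Ht. }
{ apply is_RInt_gen_Im, HI. }
destruct (HS1 _ Ha) as [La1 [HLa1 Sa1]]; destruct (HS1 _ Hb) as [Lb1 [HLb1 Sb1]].
destruct (HS2 _ Ha) as [La2 [HLa2 Sa2]]; destruct (HS2 _ Hb) as [Lb2 [HLb2 Sb2]].
exists (fun n => (J1 n, J2 n)), (La1 - Lb2, La2 + Lb1); split; [|split].
- intros n; apply is_RInt_gen_pair.
  + apply (is_RInt_gen_ext_01 (fun t => t ^ n * Re (g t))); [|exact (HJ1 n)].
    intros t _; symmetry; apply Re_RtoC_mult.
  + apply (is_RInt_gen_ext_01 (fun t => t ^ n * Im (g t))); [|exact (HJ2 n)].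
    intros t _; symmetry; apply Im_RtoC_mult.
- apply is_RInt_gen_pair.
  + refine (is_RInt_gen_ext_01 _ _ _ _ (is_RInt_gen_minus _ _ _ _ HLa1 HLb2)).
    intros t _; rewrite Cexp_PSeries; reflexivity.
  + refine (is_RInt_gen_ext_01 _ _ _ _ (is_RInt_gen_plus _ _ _ _ HLa2 HLb1)).
    intros t _; rewrite Cexp_PSeries; reflexivity.
- apply is_Cseries_pair.
  + exact (is_series_minus _ _ _ _ Sa1 Sb2).
  + exact (is_series_plus _ _ _ _ Sa2 Sb1).
Qed.

(** * The two integral representations *)

Open Scope C_scope.

(** Definedness is assumed, through [Hdef], for M-beta at (lambda_2, lambda_3 - lambda_2). Existence
    of all shifted M-beta integrals, convergence of the series in n and existence of both integrals
    are conclusions. *)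
Theorem theorem4p8
  (p q : nat) (kappa mu : list C) (alpha beta l2 l3 rho z : C)
  (Hp : length kappa = p) (Hq : length mu = q)
  (Hkappa : forall k : C, In k kappa -> ~ nonpos_int k)
  (Hmu : forall k : C, In k mu -> ~ nonpos_int k)
  (Halpha : (0 < Re alpha)%R)
  (Hl2 : (0 < Re l2)%R) (Hl3 : (Re l2 < Re l3)%R)
  (Hrho : (0 < Re rho)%R)
  (Hdef : ex_MBeta kappa mu alpha beta l2 (l3 - l2) rho) :
  let f1 := fun t : R =>
    Rcpow t (l2 - 1) * Rcpow (1 - t) (l3 - l2 - 1) * Cexp (z * RtoC t)
    * Mseries kappa mu alpha beta (- rho / RtoC (t * (1 - t))) in
  let f2 := fun u : R =>
    Rcpow u (l3 - l2 - 1) * Rcpow (1 - u) (l2 - 1) * Cexp (z * RtoC (1 - u))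
    * Mseries kappa mu alpha beta (- rho / RtoC (u * (1 - u))) in
  ex_MPhi kappa mu alpha beta l2 l3 z rho /\
  (ex_int01 f1 /\
   MPhi kappa mu alpha beta l2 l3 z rho = 1 / Beta l2 (l3 - l2) * int01 f1) /\
  (ex_int01 f2 /\
   MPhi kappa mu alpha beta l2 l3 z rho = 1 / Beta l2 (l3 - l2) * int01 f2).
Proof.
intros f1 f2.
destruct Hdef as [HM [I HI]].
set (g := MBeta_integrand kappa mu alpha beta l2 (l3 - l2) rho) in HI.
assert (Hg : forall t, (0 < t < 1)%R -> continuous_parts g t).
{ intros t Ht; apply continuous_parts_mult; [apply continuous_parts_mult|].
  - apply continuous_parts_Rcpow; lra.
  - apply continuous_parts_Rcpow_compl; lra.
  - apply continuous_parts_Mseries; trivial. }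
destruct (is_RInt_gen_Cexp_mult_01 g z I Hg HI) as [J [L [HJ [HL HS]]]].
(* Raising lambda_2 by n multiplies the integrand by t^n, so each M-beta value in the series is the
   n-th moment of g. *)
assert (HB : forall n, @is_RInt_gen C_R_NormedModule
  (MBeta_integrand kappa mu alpha beta (l2 + RtoC (INR n)) (l3 - l2) rho)
  (at_right 0) (at_left 1) (J n)).
{ intros n; refine (is_RInt_gen_C_ext_01 _ _ _ _ (HJ n)).
  intros t Ht; unfold g, MBeta_integrand.
  replace (l2 + RtoC (INR n) - 1) with (l2 - 1 + RtoC (INR n)) by ring.
  rewrite Rcpow_plus_INR by apply Ht; ring. }
assert (Hf1 : @is_RInt_gen C_R_NormedModule f1 (at_right 0) (at_left 1) L).
{ refine (is_RInt_gen_C_ext_01 _ _ _ _ HL).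
  intros t _; unfold f1, g, MBeta_integrand, Marg; ring. }
assert (Hf2 : @is_RInt_gen C_R_NormedModule f2 (at_right 0) (at_left 1) L).
{ refine (is_RInt_gen_C_ext_01 _ _ _ _ (is_RInt_gen_reflect_01 (V := C_R_NormedModule) _ _ Hf1)).
  intros t _; unfold f1, f2.
  replace (1 - (1 - t))%R with t by ring.
  (* The product t(1-t) is invariant under reflection, so the argument of the M-series is
     unchanged. *)
  rewrite (Rmult_comm (1 - t) t); ring. }
assert (HPhi : @is_series C_AbsRing C_NormedModule
  (MPhi_term kappa mu alpha beta l2 l3 z rho) (1 / Beta l2 (l3 - l2) * L)).
{ refine (is_series_ext _ _ _ _ (is_series_scal (V := C_NormedModule) (1 / Beta l2 (l3 - l2)) _ _ HS)).
  intros n; unfold MPhi_term, MBeta; rewrite (int01_unique _ _ (HB n)).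
  change (1 / Beta l2 (l3 - l2) * (expcoef z n * J n)
    = J n / Beta l2 (l3 - l2) * expcoef z n).
  unfold Cdiv; ring. }
assert (HE : MPhi kappa mu alpha beta l2 l3 z rho = 1 / Beta l2 (l3 - l2) * L)
  by exact (Cseries_unique _ _ HPhi).
rewrite (int01_unique _ _ Hf1), (int01_unique _ _ Hf2).
split; [split|split; split; trivial].
- intros n; split; [exact HM | exists (J n); apply HB].
- eexists; exact HPhi.
- exists L; exact Hf1.
- exists L; exact Hf2.
Qed.
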